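(* Let $k\geq 2$ and $\ell\geq 1$ be integers. Let $\delta=k\ell$ and $t=k+\left\lfloor\frac{k-2}{\ell}\right\rfloor$. Consider the game of $\frac1k$-majority on-line edge-colouring of a graph in which the final graph must have minimum degree $\delta$. Then the Presenter has a strategy forcing the Algorithm to use at least $2t+1$ colours.
   Context: All graphs are finite and simple. For an integer $k\geq 2$, a $\frac1k$-majority edge-colouring of a graph $G$ is a (not necessarily proper) colouring of the edges of $G$ such that, for every vertex $v$ of $G$ and every colour $c$, at most $d_G(v)/k$ of the edges incident with $v$ have colour $c$. On-line game with minimum degree $\delta\geq k$: the integers $k$ and $\delta$ are fixed and known to both players before the game. Two players, the Presenter and the Algorithm, start with an edgeless graph. In each round the Presenter reveals one new edge, possibly using previously unused vertices (there is no bound on the number of vertices); its endpoints are identified to the Algorithm. The Algorithm must immediately and irrevocably assign a colour to this edge, knowing only the part of the graph revealed so far and its colouring. The Presenter may choose each edge depending on the whole history of the game, including all colours assigned so far. After finitely many rounds the Presenter ends the game; the graph formed by all revealed edges is the final graph (it has no vertices of degree $0$), and its minimum degree must equal $\delta$. Vertices of smaller degree may appear during the game. The Algorithm's goal is that the resulting colouring of the final graph is a $\frac1k$-majority edge-colouring. The Presenter has a strategy forcing the Algorithm to use at least $m$ colours if the Presenter can play so that, whatever the Algorithm does, the game ends with an admissible final graph and the resulting colouring either is not a $\frac1k$-majority edge-colouring of the final graph or uses at least $m$ distinct colours. *)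

(* Defs.v *)
From mathcomp Require Import all_boot.

Set Implicit Arguments.
Unset Strict Implicit.
Unset Printing Implicit Defensive.

(* Vertices and colours are drawn from the infinite supply nat.  An edge is a
   pair of endpoints whose order is immaterial: [(u, v)] and [(v, u)] denote
   the same edge, and [legal] below never lets both be revealed. *)
Definition vertex := nat.
Definition colour := nat.
Definition edge := (vertex * vertex)%type.

(* The coloured edges revealed so far, most recent first. *)
Definition history := seq (edge * colour).

Definition edges (h : history) : seq edge := [seq r.1 | r <- h].

Definition incident (v : vertex) (e : edge) : bool := (v == e.1) || (v == e.2).

Definition degree (h : history) (v : vertex) : nat :=
  count (incident v) (edges h).

Definition colour_degree (h : history) (v : vertex) (c : colour) : nat :=
  count (fun r : edge * colour => incident v r.1 && (r.2 == c)) h.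

Definition is_vertex (h : history) (v : vertex) : bool :=
  has (incident v) (edges h).

Definition min_degree_eq (h : history) (d : nat) : Prop :=
  (forall v, is_vertex h v -> d <= degree h v) /\
  (exists v, is_vertex h v /\ degree h v = d).

Definition majority_colouring (k : nat) (h : history) : Prop :=
  forall (v : vertex) (c : colour), k * colour_degree h v c <= degree h v.

Definition colours_used (h : history) : nat := size (undup [seq r.2 | r <- h]).

(* The graph stays simple: no loop and no repeated edge. *)
Definition legal (h : history) (e : edge) : bool :=
  [&& e.1 != e.2, (e.1, e.2) \notin edges h & (e.2, e.1) \notin edges h].

(* [None] means that the Presenter ends the game. *)
Definition presenter := history -> option edge.
Definition algorithm := history -> edge -> colour.

(* Histories reached when P plays against A.  A play in which P makes an
   illegal move goes no further, and in particular never ends. *)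
Inductive reached (P : presenter) (A : algorithm) : history -> Prop :=
| reached_start : reached P A [::]
| reached_round h e :
    reached P A h -> P h = Some e -> legal h e ->
    reached P A ((e, A h e) :: h).

Definition ends_with (P : presenter) (A : algorithm) (h : history) : Prop :=
  reached P A h /\ P h = None.

Definition presenter_forces (k delta m : nat) : Prop :=
  exists P : presenter, forall A : algorithm, exists h : history,
    [/\ ends_with P A h,
        min_degree_eq h delta
      & ~ majority_colouring k h \/ m <= colours_used h].

(* Main.v *)
Require Import Defs.
From mathcomp Require Import all_boot.
From mathcomp Require Import zify.
From Stdlib Require Import IndefiniteDescription.

Set Implicit Arguments.
Unset Strict Implicit.
Unset Printing Implicit Defensive.

(** The bound [2 * t + 1] comes from one arithmetic fact about a single vertex
    and one way of joining vertices in pairs.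

    By the choice of [t], the number [l * t + 1] lies between [k * l] and
    [k * (l + 1) - 1], so at a vertex of that final degree the majority condition
    allows each colour at most [l] times.  Hence such a vertex sees at least
    [t + 1] colours ([majority_degree_le]).

    Split the colours into the early ones, namely the first [t] to appear in
    the game, and the late ones.  This split never changes for a colour that has
    already been used ([early_cat]), and if at most [2 * t] colours are used then
    each side has at most [t] of them ([pure_palette]).  So the Presenter wins by
    producing one vertex of degree [l * t + 1] all of whose edges are early, or
    all of whose edges are late.

    To produce it, join an all-early vertex [x] to an all-late vertex [y].
    Whatever colour the new edge receives, either [x] stays all-early or [y]
    stays all-late, so one of them has gained a degree while keeping its type.
    The other one is abandoned; since new vertices are free, the Presenter can
    build a replacement elsewhere, and a double induction on the two degrees
    reaches any target ([forces_pure]).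

    It remains to repair the abandoned vertices so that the final minimum degree
    is exactly [k * l] while the chosen vertex is left alone.  One complete
    bipartite graph does this ([forces_completion]). *)

(** * From forced positions to strategies *)

(** The positions from which the Presenter can force [Q], as the well-founded
    tree of the game.  Winning is proved on this predicate, where plays compose,
    and only then turned into a function on histories. *)
Inductive forces (Q : history -> Prop) (h : history) : Prop :=
| forces_now of Q h
| forces_reveal e of legal h e & (forall c, forces Q ((e, c) :: h)).

Lemma forces_bind Q R h :
  forces Q h -> (forall h', Q h' -> forces R h') -> forces R h.
Proof.
move=> FQ QR; elim: h / FQ => [h /QR //|h e lhe _ IH].
exact: forces_reveal lhe IH.
Qed.

(** The strategy is assembled up the tree: at a node the history itself tells
    which colour was answered there, namely the entry just above [h], and so
    which subtree is being played.  The conclusion speaks of any presenter [P']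
    that agrees with [P] from [h] on, because in the induction [P] is only one
    branch of the strategy really played. *)
Lemma forces_strategy Q h : forces Q h ->
  exists P : presenter, forall (P' : presenter) (A : algorithm),
    (forall g, P' (g ++ h) = P (g ++ h)) -> reached P' A h ->
    exists h', ends_with P' A h' /\ Q h'.
Proof.
elim: h / => [h Qh|h e lhe _ IH].
  exists (fun=> None) => P' A eqP hP; exists h; split=> //; split=> //.
  exact: (eqP [::]).
have [F HF] := functional_choice _ IH.
pose answer h' : colour := (nth ((0, 0), 0) h' (size h' - (size h).+1)).2.
exists (fun h' => if size h' == size h then Some e else F (answer h') h').
move=> P' A eqP hP; apply: (HF (A h e) P' A) => [g|].
  have -> : g ++ (e, A h e) :: h = rcons g (e, A h e) ++ h by rewrite cat_rcons.
  rewrite eqP cat_rcons.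
  have -> : answer (g ++ (e, A h e) :: h) = A h e.
    by rewrite /answer size_cat /= addnK nth_cat ltnn subnn.
  by rewrite size_cat /= -{2}[size h]add0n -addSnnS eqn_add2r.
by apply: reached_round => //; rewrite (eqP [::]) /= eqxx.
Qed.

Lemma forces_presenter k delta m :
  forces (fun h => min_degree_eq h delta /\
                   (~ majority_colouring k h \/ m <= colours_used h)) [::] ->
  presenter_forces k delta m.
Proof.
move=> /forces_strategy[P HP]; exists P => A.
have [//||h [endh [mdh winh]]] := HP P A; first exact: reached_start.
by exists h; split.
Qed.

(** Edges fixed in advance can be revealed without looking at the answers. *)
Lemma forces_edges es h :
    uniq es -> (forall e, e \in es -> (e.2, e.1) \notin es) ->
    (forall e, e \in es -> legal h e) ->
  forces (fun h' => exists2 g, h' = g ++ h & perm_eq (edges g) es) h.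
Proof.
elim: es h => [|e es IH] h /=.
  by move=> _ _ _; apply: forces_now; exists [::].
move=> /andP[e_es uniq_es] flip_es leg_es.
apply: (forces_reveal (e := e)) => [|c]; first by apply: leg_es; rewrite mem_head.
apply: forces_bind (IH ((e, c) :: h) uniq_es _ _) _.
- move=> f f_es; have := flip_es f; rewrite !inE f_es orbT => /(_ isT).
  by rewrite negb_or => /andP[].
- move=> f f_es; have := leg_es f; rewrite inE f_es orbT => /(_ isT).
  rewrite /legal /= !inE !negb_or => /and3P[-> -> ->].
  have /= := flip_es f; rewrite !inE f_es orbT => /(_ isT).
  rewrite negb_or => /andP[-> _]; rewrite !andbT /=.
  by apply: contraNneq e_es => <-; case: (f) f_es.
move=> h' [g -> gP]; apply: forces_now; exists (rcons g (e, c)).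
  by rewrite cat_rcons.
by rewrite /edges map_rcons perm_rcons perm_cons.
Qed.

(** * Degrees along a history *)

Lemma degree_cat g h v : degree (g ++ h) v = degree g v + degree h v.
Proof. by rewrite /degree /edges map_cat count_cat. Qed.

Lemma degree_cons e c h v : degree ((e, c) :: h) v = incident v e + degree h v.
Proof. by []. Qed.

Lemma is_vertexE h v : is_vertex h v = (0 < degree h v).
Proof. exact: has_count. Qed.

Lemma degree0_notin h v e : degree h v = 0 -> incident v e -> e \notin edges h.
Proof.
move/eqP; rewrite -leqn0 leqNgt -is_vertexE => /hasPn hv.
by apply: contraL => /hv.
Qed.

Lemma degree0P h v :
  reflect (forall r, r \in h -> ~~ incident v r.1) (degree h v == 0).
Proof.
rewrite -leqn0 leqNgt /degree -has_count; apply: (iffP idP).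
  by move=> /hasPn H r rh; apply/H/map_f.
by move=> H; apply/hasPn => e /mapP[r rh ->]; apply: H.
Qed.

(** * Early and late colours *)

(** The colours in order of first appearance: [undup] keeps the last occurrence
    of a colour in the history, which is the oldest one. *)
Definition palette (h : history) : seq colour := rev (undup [seq r.2 | r <- h]).

Definition early (t : nat) (h : history) (c : colour) : bool :=
  c \in take t (palette h).

Lemma mem_palette h r : r \in h -> r.2 \in palette h.
Proof. by move=> rh; rewrite mem_rev mem_undup map_f. Qed.

(** New colours enter at the end of the palette.  A used colour that is not among
    the first [t] is preceded by [t] others, so it stays late for ever. *)
Lemma early_cat t g h c :
  c \in palette h -> early t (g ++ h) c = early t h c.
Proof.
rewrite /early /palette map_cat undup_cat rev_cat take_cat => cP.
case: ltnP => // le_t; by rewrite mem_cat (take_oversize le_t) cP.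
Qed.

Definition pure (t : nat) (b : bool) (h : history) (v : vertex) : Prop :=
  forall r, r \in h -> incident v r.1 -> early t h r.2 = b.

Lemma pure_cat t b g h v :
  degree g v = 0 -> pure t b h v -> pure t b (g ++ h) v.
Proof.
move=> /eqP/degree0P g0 pv r; rewrite mem_cat => /orP[/g0/negbTE-> //|rh] inc.
by rewrite early_cat ?mem_palette // pv.
Qed.

(** The step behind the whole strategy: an edge that takes its colour on
    the side [b] extends a vertex that is pure of that side. *)
Lemma pure_cons t b e c h v :
    early t ((e, c) :: h) c = b -> pure t b h v -> pure t b ((e, c) :: h) v.
Proof.
move=> cb pv r; rewrite inE => /orP[/eqP-> //|rh] inc.
by rewrite (early_cat t [:: (e, c)]) ?mem_palette // pv.
Qed.

(** * Forcing a pure vertex of large degree *)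

Definition below (N : nat) (h : history) : Prop :=
  forall v, N <= v -> degree h v = 0.

Definition above (N : nat) (h : history) : Prop :=
  forall v, v < N -> degree h v = 0.

Lemma below_exists M h : exists2 N, M <= N & below N h.
Proof.
elim: h => [|[[x y] c] h [N MN hN]]; first by exists M.
exists (maxn N (maxn x.+1 y.+1)); first by rewrite leq_max MN.
move=> v; rewrite !geq_max => /and3P[/hN hv xv yv].
by rewrite degree_cons hv /incident /= !gtn_eqF.
Qed.

Lemma above_cat N g1 g2 : above N g1 -> above N g2 -> above N (g1 ++ g2).
Proof. by move=> N1 N2 v vN; rewrite degree_cat N1 ?N2. Qed.

Lemma aboveW M N g : M <= N -> above N g -> above M g.
Proof. by move=> MN gN v vM; apply/gN/(leq_trans vM). Qed.

(** Double induction: the two shorter games supply, on disjoint sets of vertices,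
    an early vertex of degree [a] and a late one of degree [b], unless one of
    them already reaches the goal; the edge between the two then
    promotes one of them.  Playing above [N] keeps the games disjoint. *)
Lemma forces_pure t a b N h : below N h ->
  forces (fun h' => exists g v, [/\ h' = g ++ h, above N g, N <= v &
    (degree h' v = a /\ pure t true h' v) \/
    (degree h' v = b /\ pure t false h' v)]) h.
Proof.
have fresh s h0 N0 : below N0 h0 -> degree h0 N0 = 0 /\ pure t s h0 N0.
  move=> /(_ _ (leqnn N0)) d0; split=> // r rh inc.
  by move/eqP/degree0P: d0 => /(_ r rh); rewrite inc.
elim: a b N h => [|a IHa] b N h hN.
  by apply: forces_now; exists [::], N; split=> //; left; apply: fresh.
elim: b N h hN => [|b IHb] N h hN.
  by apply: forces_now; exists [::], N; split=> //; right; apply: fresh.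
apply: forces_bind (IHa b.+1 N h hN) _ => h1 [g1 [x [-> g1N Nx]]].
case=> [[dx px]|?]; last by apply: forces_now; exists g1, x; split=> //; right.
have [N' leN' h1N'] := below_exists (maxn N x.+1) (g1 ++ h).
move: leN'; rewrite geq_max => /andP[leNN' ltxN'].
apply: forces_bind (IHb N' (g1 ++ h) h1N') _ => h2 [g2 [y [-> g2N' N'y]]].
have g21N : above N (g2 ++ g1) by apply: above_cat => //; apply: aboveW g2N'.
have Ny := leq_trans leNN' N'y.
case=> [?|[dy py]].
  by apply: forces_now; exists (g2 ++ g1), y; rewrite -catA; split=> //; left.
have ltxy := leq_trans ltxN' N'y.
(* Every old edge lies below [N'] or above it, while [x < N' <= y]. *)
have nadj e : incident x e -> incident y e -> e \notin edges (g2 ++ g1 ++ h).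
  rewrite /edges map_cat mem_cat negb_or => xe ye; apply/andP; split.
    exact: (degree0_notin (g2N' _ ltxN')).
  exact: (degree0_notin (h1N' _ N'y)).
have leg : legal (g2 ++ g1 ++ h) (x, y).
  by rewrite /legal !nadj /incident ?eqxx ?orbT //= ltn_eqF.
apply: forces_reveal leg _ => c.
have h3N : above N (((x, y), c) :: g2 ++ g1).
  move=> v vN; rewrite degree_cons g21N // /incident /=.
  by rewrite !ltn_eqF // (leq_trans vN).
apply: forces_now; case cb: (early t (((x, y), c) :: g2 ++ g1 ++ h) c).
  exists (((x, y), c) :: g2 ++ g1), x; split=> //; first by rewrite /= -catA.
  left; split; last by apply: pure_cons => //; apply: pure_cat => //; apply: g2N'.
  by rewrite degree_cons /incident eqxx degree_cat g2N' // dx.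
exists (((x, y), c) :: g2 ++ g1), y; split=> //; first by rewrite /= -catA.
right; split; last exact: pure_cons.
by rewrite degree_cons /incident eqxx orbT dy.
Qed.

(** * Reaching the prescribed minimum degree *)

(** Degrees in the complete bipartite graph between [A] and [B]; multiplicities
    stand for membership, so that repetitions need no separate treatment. *)
Lemma count_incident_allpairs (A B : seq nat) v :
    (v \in A -> v \notin B) ->
  count (incident v) [seq (a, b) | a <- A, b <- B] =
    count_mem v A * size B + size A * count_mem v B.
Proof.
elim: A => [//|a A IH] vAB; rewrite allpairs_cons count_cat count_map.
rewrite IH => [|vA]; last by apply: vAB; rewrite inE vA orbT.
rewrite /= mulnDl mulSn; case: (eqVneq a v) vAB => [-> vB|av _].
  rewrite (count_memPn (vB (mem_head _ _))) !muln0 !addn0 mul1n; congr (_ + _).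
  by rewrite -(count_predT B); apply: eq_count => b; rewrite /= /incident eqxx.
rewrite mul0n add0n addnCA; congr (_ + (_ + _)); apply: eq_count => b.
by rewrite /= /incident /= eq_sym (negbTE av) eq_sym.
Qed.

(** Every vertex except [v] is joined to [delta] fresh vertices [X], and so are
    [delta] further fresh vertices [Y].  The vertices of [Y] end with degree
    exactly [delta], and they are numerous enough for those of [X]. *)
Lemma forces_completion delta h v :
    0 < delta -> is_vertex h v -> delta <= degree h v ->
  forces (fun h' => min_degree_eq h' delta /\
                    exists2 g, h' = g ++ h & degree g v = 0) h.
Proof.
move=> d_gt0 v_h dv.
have [N _ hN] := below_exists 0 h.
pose U := [seq u <- iota 0 N | is_vertex h u & u != v].
pose X := iota N delta; pose Y := iota (N + delta) delta.
pose es : seq edge := [seq (u, x) | u <- U ++ Y, x <- X].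
have vertN u : is_vertex h u -> u < N.
  by rewrite is_vertexE [u < N]ltnNge; apply: contraL => /hN ->.
have mU u : (u \in U) = is_vertex h u && (u != v).
  rewrite mem_filter mem_iota add0n; case: (boolP (is_vertex h u)) => // /vertN.
  by move=> uN; rewrite uN /= andbT.
have mX x : (x \in X) = (N <= x < N + delta) by rewrite mem_iota.
have mY y : (y \in Y) = (N + delta <= y < N + delta + delta) by rewrite mem_iota.
have UYX u : u \in U ++ Y -> u \notin X.
  rewrite mem_cat mU mY mX => /orP[/andP[/vertN]|]; lia.
have uniqUY : uniq (U ++ Y).
  rewrite cat_uniq filter_uniq ?iota_uniq // andbT; apply/hasPn => u.
  by rewrite mY mU => uY; apply/negP => /andP[/vertN uN _]; lia.
have mes e : e \in es -> (e.1 \in U ++ Y) && (e.2 \in X).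
  by move=> /allpairsP[[u x] [/= ? ? ->]]; apply/andP.
have cnt u : count (incident u) es =
    count_mem u (U ++ Y) * delta + (size U + delta) * count_mem u X.
  by rewrite count_incident_allpairs ?size_cat ?size_iota //; apply: UYX.
apply: forces_bind (@forces_edges es h _ _ _) _.
- by apply: allpairs_uniq (iota_uniq _ _) _ => // -[? ?] [? ?].
- move=> e /mes/andP[_ e2X]; apply/negP => /mes/= /andP[/UYX].
  by rewrite e2X.
- move=> e /mes/andP[e1UY e2X].
  have he2 : degree h e.2 = 0 by apply: hN; move: e2X; rewrite mX => /andP[].
  rewrite /legal !(degree0_notin he2) ?/incident ?eqxx ?orbT //= andbT.
  by apply: contraTneq e2X => <-; apply: UYX.
move=> h' [g -> gP]; apply: forces_now.
have dg u : degree g u = count (incident u) es by apply: (permP gP).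
have uy y : y \in U ++ Y -> degree g y = delta.
  move=> yUY; rewrite dg cnt (count_uniq_mem _ uniqUY) yUY.
  by rewrite (count_memPn (UYX _ yUY)) muln0 addn0 mul1n.
split; last first.
  exists g => //; rewrite dg cnt !(count_memPn _) ?muln0 //.
    by rewrite mX; apply: contraL (vertN _ v_h); lia.
  by rewrite mem_cat mU eqxx andbF mY /=; have := vertN _ v_h; lia.
split=> [u|].
  rewrite is_vertexE degree_cat.
  case: (boolP (u \in U ++ Y)) => [/uy-> _|uUY]; first exact: leq_addr.
  case: (boolP (u \in X)) => [uX _|uX].
    rewrite dg cnt (count_memPn uUY) (count_uniq_mem _ (iota_uniq _ _)).
    by rewrite uX; lia.
  rewrite dg cnt !(count_memPn _) // muln0 -is_vertexE.
  move=> uh; move: uUY; rewrite mem_cat mU uh negb_or /= negbK.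
  by case/andP => /eqP->.
have NY : N + delta \in U ++ Y by rewrite mem_cat mY; lia.
exists (N + delta); rewrite is_vertexE degree_cat uy // hN ?leq_addr // addn0.
by [].
Qed.

(** * The pigeonhole at a vertex *)

Lemma degree_le_colours (s : seq colour) h v m :
    (forall r, r \in h -> incident v r.1 -> r.2 \in s) ->
    (forall c, colour_degree h v c <= m) ->
  degree h v <= size s * m.
Proof.
move=> hs hm; apply: (@leq_trans (\sum_(c <- s) colour_degree h v c)).
  elim: h hs {hm} => [|r h IH] hs; first by rewrite /degree.
  rewrite /colour_degree /= big_split /= leq_add ?IH //; last first.
    by move=> q qh; apply: hs; rewrite inE qh orbT.
  case vr: (incident v r.1) => //.
  by rewrite (big_rem r.2) /= ?eqxx // hs ?mem_head.
by rewrite -sum1_size big_distrl /=; apply: leq_sum => c _; rewrite mul1n.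
Qed.

(** Below degree [k * (l + 1)] the majority condition caps every colour at [l],
    so [size s] colours cover at most [size s * l] edges. *)
Lemma majority_degree_le k l (s : seq colour) h v :
    majority_colouring k h -> degree h v < k * l.+1 ->
    (forall r, r \in h -> incident v r.1 -> r.2 \in s) ->
  degree h v <= size s * l.
Proof.
move=> maj dv hs; apply: degree_le_colours hs _ => c.
have := leq_ltn_trans (maj v c) dv; rewrite ltn_mul2l => /andP[_].
by rewrite ltnS.
Qed.

(** The list [s] is one half of the palette: [t] early colours leave at most
    [2 * t - t] late ones, and with fewer than [t] early ones none is late. *)
Lemma pure_palette t b h v :
    colours_used h <= 2 * t -> pure t b h v ->
  exists2 s : seq colour, size s <= t &
    forall r, r \in h -> incident v r.1 -> r.2 \in s.
Proof.
rewrite /colours_used -size_rev -/(palette h) => used pv.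
exists (if b then take t (palette h) else drop t (palette h)).
  case: b {pv}; first by rewrite size_take_min geq_minl.
  by rewrite size_drop leq_subLR addnn -mul2n.
move=> r rh /(pv r rh); case: b {pv} => //; rewrite /early => /negbT nearly.
have := mem_palette rh; rewrite -{1}(cat_take_drop t (palette h)) mem_cat.
by rewrite (negbTE nearly).
Qed.

Theorem theorem8 (k l : nat) (hk : 2 <= k) (hl : 1 <= l) :
  let delta := k * l in
  let t := k + (k - 2) %/ l in
  presenter_forces k delta (2 * t + 1).
Proof.
move=> delta t; apply: forces_presenter.
have delta_lt : delta < l * t + 1.
  by rewrite addn1 ltnS /delta mulnC leq_mul2l leq_addr orbT.
have lt_window : l * t + 1 < k * l.+1.
  have : (k - 2) %/ l * l <= k - 2 by exact: leq_divM.
  by rewrite /t mulnDr mulnS [k * l]mulnC [_ %/ l * l]mulnC; lia.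
apply: forces_bind (@forces_pure t (l * t + 1) (l * t + 1) 0 [::] _) _ => //.
move=> h [_ [v [_ _ _ hv]]].
have [dv [b pv]] : degree h v = l * t + 1 /\ exists b, pure t b h v.
  by case: hv => -[dv pv]; split=> //; [exists true|exists false].
apply: forces_bind (@forces_completion delta h v _ _ _) _.
- by rewrite muln_gt0 hl andbT; lia.
- by rewrite is_vertexE dv addn1.
- by rewrite dv ltnW.
move=> h' [mdh [g def_h gv]]; apply: forces_now; split=> // {mdh}.
rewrite {h'}def_h.
case: (leqP (2 * t + 1) (colours_used (g ++ h))) => used; [by right|left=> maj].
have dv' : degree (g ++ h) v = l * t + 1 by rewrite degree_cat gv dv.
have used' : colours_used (g ++ h) <= 2 * t by move: used; rewrite addn1.
have [s st hs] := pure_palette used' (pure_cat gv pv).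
have := majority_degree_le maj _ hs; rewrite dv' => /(_ _ lt_window).
by apply/negP; rewrite -ltnNge addn1 ltnS mulnC leq_mul2l st orbT.
Qed.
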